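(* Let $q$ be a prime power, let $p$ be the characteristic of $\mathbb{F}_q$, let $n$ be a positive integer, and write $n=p^s n_0$ with $s\ge 0$ and $\gcd(n_0,p)=1$. Let $d$ be the least positive integer such that $q^d\equiv 1\pmod{n_0}$. For each positive integer $r$ let $v_r$ be the number of distinct monic irreducible factors of degree $r$ of $x^n-1$ over $\mathbb{F}_q$. Then the number $N_1$ of $1$-normal elements of $\mathbb{F}_{q^n}$ over $\mathbb{F}_q$ is $$N_1=\begin{cases} v_1\,q^{n-n_0-1}\displaystyle\prod_{r\mid d}(q^r-1)^{v_r} & \text{if } n\neq n_0,\\[2ex] v_1\,(q-1)^{v_1-1}\displaystyle\prod_{\substack{r\mid d\\ r\neq 1}}(q^r-1)^{v_r} & \text{if } n=n_0.\end{cases}$$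
   Context: For $\alpha\in\mathbb{F}_{q^n}$ put $g_\alpha(x)=\sum_{i=0}^{n-1}\alpha^{q^i}x^{n-1-i}\in\mathbb{F}_{q^n}[x]$. For $0\le k\le n$, the element $\alpha$ is called $k$-normal over $\mathbb{F}_q$ if $\gcd(x^n-1,g_\alpha(x))$, computed over $\mathbb{F}_{q^n}$, has degree $k$; here $\gcd(x^n-1,0)=x^n-1$, so $\alpha=0$ is the unique $n$-normal element. Products over $r\mid d$ run over the positive divisors $r$ of $d$; empty products equal $1$. *)

(* Defs.v *)
From mathcomp Require Import all_boot all_algebra all_field.

Set Implicit Arguments.
Unset Strict Implicit.
Unset Printing Implicit Defensive.

Import GRing.Theory.

Local Open Scope ring_scope.

(* L is the extension F_(q^n) of F = F_q, so q = #|F| and n = \dim {:L}. *)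
Definition conj_poly (F : finFieldType) (L : fieldExtType F) (a : L) :
    {poly L} :=
  \sum_(i < \dim {:L}) (a ^+ (#|F| ^ i)%N) *: 'X^((\dim {:L}).-1 - i).

(* size is degree + 1, and gcdp ('X^n - 1) 0 = 'X^n - 1 (lemma gcdp0). *)
Definition k_normal (F : finFieldType) (L : fieldExtType F) (k : nat)
    (a : L) : bool :=
  size (gcdp ('X^(\dim {:L}) - 1) (conj_poly a)) == k.+1.

(* finvect_type L is L itself, seen as a finite type. *)
Definition num_k_normal (F : finFieldType) (L : fieldExtType F) (k : nat) :
    nat :=
  #|[set a : finvect_type L | k_normal k (a : L)]|.

(* {poly_(r.+1) F}, the polynomials of degree at most r, is a finite type. *)
Definition num_irr_factors (F : finFieldType) (f : {poly F}) (r : nat) : nat :=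
  #|[set h : {poly_(r.+1) F} |
      [&& size h == r.+1, val h \is monic, irreducibleb (val h)
        & val h %| f]]|.

(* Main.v *)
(** Let [f = X^n - 1] and let [g_a] be the conjugate polynomial of [a].  Modulo
    [f], multiplying [g_a] by [C] in [F[X]] gives the conjugate polynomial of
    [C(Frobenius)(a)], so for [f = D C] the condition [D | g_a] says that [a] is
    in the kernel of [C(Frobenius)].  This kernel has at most [q^(deg C)]
    elements, being a set of roots of a q-polynomial; since the image of
    [C(Frobenius)] lies in the kernel of [D(Frobenius)], it has exactly that
    many, and [D | g_a] has [q^(n - deg D)] solutions.  Inclusion-exclusion over
    the irreducible factors then counts the [a] for which the gcd of [f] and
    [g_a], which is invariant under Frobenius and hence defined over [F], is a
    given linear factor of [f]. *)

Require Import Defs.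
From HB Require Import structures.
From mathcomp Require Import all_boot all_algebra all_field.

Set Implicit Arguments.
Unset Strict Implicit.
Unset Printing Implicit Defensive.

Import GRing.Theory.

Local Open Scope ring_scope.

Lemma size_mul_pred (R : idomainType) (f g : {poly R}) :
  f * g != 0 -> (size (f * g)).-1 = ((size f).-1 + (size g).-1)%N.
Proof.
rewrite mulf_eq0 negb_or => /andP[nzf nzg]; rewrite size_mul //.
move: nzf nzg; rewrite -!size_poly_gt0.
by move: (size f) (size g) => [|i] [|j]; rewrite ?addnS.
Qed.

Lemma Xn_sub_1_neq0 (R : nzRingType) m :
  (0 < m)%N -> 'X^m - 1 != 0 :> {poly R}.
Proof. by move=> m_gt0; rewrite monic_neq0 ?monic_Xn_sub_1. Qed.

(** * Factorization into monic irreducibles over a finite field *)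

Section Factorization.

Variable F : finFieldType.
Implicit Types (P Q f : {poly F}) (s : seq {poly F}).

Definition monic_irr P := (P \is monic) && irreducibleb P.

Lemma monic_irrP P : reflect (P \is monic /\ irreducible_poly P) (monic_irr P).
Proof. by apply: (iffP andP) => -[? /irreducibleP]. Qed.

Lemma exists_monic_irr_factor f :
  (1 < size f)%N -> exists2 P, monic_irr P & P %| f.
Proof.
have [n] := ubnP (size f); elim: n => // n IHn in f *; rewrite ltnS => le_n f1.
have f0 : lead_coef f != 0 by rewrite lead_coef_eq0 -size_poly_gt0 ltnW.
have [irr_f | ] := boolP (irreducibleb f).
  exists ((lead_coef f)^-1 *: f); last by rewrite dvdpZl ?invr_eq0.
  apply/monic_irrP; split.
    by apply/monicP; rewrite lead_coefZ mulVf.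
  have [_ irr] := irreducibleP _ irr_f; split.
    by rewrite size_scale ?invr_eq0.
  move=> Q Q1; rewrite dvdpZr ?invr_eq0 // => /(irr _ Q1) eqQ.
  by rewrite eqp_sym (eqp_trans (eqp_scale _ _)) ?invr_eq0 // eqp_sym.
(* [irreducibleb] tests divisors of size at most [(size f).-1], so its failure yields a nonconstant
   divisor of smaller degree for the induction. *)
rewrite /irreducibleb f1 /= negb_forall => /existsP[[Q /= leQ]].
rewrite negb_imply -ltnNge -Pdiv.Idomain.dvdpE => /andP[dvdQ Q1].
have [||P irrP dvdP] := IHn Q => //.
  by apply: leq_trans le_n; rewrite -(ltn_predK f1) ltnS; apply: leQ.
by exists P => //; apply: dvdp_trans dvdQ.
Qed.

Lemma monic_factorization f :
  f \is monic -> exists2 s, all monic_irr s & f = \prod_(P <- s) P.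
Proof.
have [n] := ubnP (size f); elim: n => // n IHn in f *; rewrite ltnS => le_n mf.
have [f1 | f1] := leqP (size f) 1.
  exists [::] => //; rewrite big_nil; apply/eqP; rewrite -eqp_monic ?monic1 //.
  by rewrite -size_poly_eq1 eqn_leq f1 size_poly_gt0 monic_neq0.
have [P irrP /dvdpP[g Df]] := exists_monic_irr_factor f1.
have [mP [P1 _]] := monic_irrP _ irrP.
have mg : g \is monic by rewrite -(monicMr _ mP) -Df.
have [||s irr_s Dg] := IHn g => //.
  apply: leq_trans le_n; rewrite Df size_Mmonic ?monic_neq0 //.
  by case: (size P) P1 => [|[|k]] // _; rewrite !addnS ltnS leq_addr.
by exists (P :: s); rewrite /= ?irrP // big_cons -Dg mulrC.
Qed.

(** An irreducible not coprime to [Q] divides it, hence is associate to it, and monic associates are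
    equal. *)
Lemma monic_irr_coprime P Q :
  monic_irr P -> monic_irr Q -> coprimep P Q = (P != Q).
Proof.
move=> /monic_irrP[mP irrP] /monic_irrP[mQ irrQ].
rewrite irreducible_poly_coprime //; congr (~~ _).
apply/idP/eqP => [dvdPQ | ->]; last exact: dvdpp.
apply/eqP; rewrite -eqp_monic //; apply: irrQ => //.
by rewrite neq_ltn irrP.1 orbT.
Qed.

Lemma monic_irr_dvd_mul P f g :
  monic_irr P -> (P %| f * g) = (P %| f) || (P %| g).
Proof.
case/monic_irrP=> _ irrP; have [dvdf | ndvdf] /= := boolP (P %| f).
  by rewrite dvdp_mulr.
by rewrite Gauss_dvdpr ?irreducible_poly_coprime.
Qed.

Lemma monic_irr_dvd_prod P s :
  monic_irr P -> all monic_irr s -> (P %| \prod_(Q <- s) Q) = (P \in s).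
Proof.
move=> irrP; elim: s => [_|Q s IHs /= /andP[irrQ irrs]].
  rewrite big_nil dvdp1; have /monic_irrP[_ [P1 _]] := irrP.
  by rewrite gtn_eqF.
rewrite big_cons monic_irr_dvd_mul // IHs // inE; congr (_ || _).
have := monic_irr_coprime irrP irrQ; rewrite irreducible_poly_coprime.
  by move/negb_inj.
by case/monic_irrP: irrP.
Qed.

(** Separability makes complementary factors coprime, so [P] cannot recur in the rest of the
    list. *)
Lemma separable_prod_uniq s :
  all monic_irr s -> separable_poly (\prod_(P <- s) P) -> uniq s.
Proof.
elim: s => //= P s IHs /andP[irrP irrs]; rewrite big_cons => sep.
have [sqf _] := separable_polyP sep; apply/andP; split.
  rewrite -monic_irr_dvd_prod //.
  have := sqf P (\prod_(Q <- s) Q) (dvdpp _).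
  by rewrite irreducible_poly_coprime //; case/monic_irrP: irrP.
apply: IHs => //; move: sep; rewrite separable_mul; by case/and3P.
Qed.

Lemma monic_linear_irr P : P \is monic -> size P = 2 -> monic_irr P.
Proof.
move=> mP szP; apply/monic_irrP; split=> //; split; first by rewrite szP.
move=> Q Q1 dvdQ; have nzP := monic_neq0 mP; rewrite -dvdp_size_eqp //.
have := dvdp_leq nzP dvdQ; have := dvdpN0 dvdQ nzP.
by rewrite -size_poly_gt0 szP; case: (size Q) Q1 => [|[|[]]].
Qed.

Lemma prod_monic_irr s : all monic_irr s -> \prod_(P <- s) P \is monic.
Proof.
by move=> irrs; rewrite big_seq rpred_prod // => P /(allP irrs) /andP[].
Qed.

Lemma size_prod_monic_irr s :
  all monic_irr s ->
  (size (\prod_(P <- s) P)).-1 = (\sum_(P <- s) (size P).-1)%N.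
Proof.
elim: s => [_|P s IHs /= /andP[/andP[mP _] irrs]].
  by rewrite !big_nil size_poly1.
rewrite !big_cons -IHs // size_mul_pred // monic_neq0 //.
by rewrite rpredM ?prod_monic_irr.
Qed.

End Factorization.

(** * Frobenius powers, conjugate polynomials and kernels of q-polynomials *)

Section Frobenius.

Variables (F : finFieldType) (L : fieldExtType F).
Local Notation n := (\dim {:L}).
Local Notation "p ^%:A" := (map_poly (in_alg L) p)
  (format "p ^%:A") : ring_scope.
Implicit Types (a b : L) (C D : {poly F}).

Definition frob i a := a ^+ (#|F| ^ i).

(** [#|F|] is a power of the characteristic, which [L] shares with [F]. *)
Lemma frob_is_zmod_morphism i : zmod_morphism (frob i).
Proof.
have [p p_pr pcharFp] := finPcharP F; move=> a b; rewrite /frob.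
have natq : [pchar L].-nat (#|F| ^ i)%N.
  rewrite (card_pprimeChar pcharFp) !pnatX (eq_pnat _ (pchar_lalg L)).
  by rewrite (eq_pnat _ (pcharf_eq pcharFp)) pnat_id.
by rewrite exprDn_pchar // exprNn_pchar.
Qed.

Lemma frob_is_monoid_morphism i : monoid_morphism (frob i).
Proof. by split=> [|a b]; rewrite /frob ?expr1n ?exprMn. Qed.

Lemma frob_alg i (x : F) : frob i x%:A = x%:A.
Proof.
elim: i => [|i IHi]; first by rewrite /frob expn0 expr1.
by rewrite /frob expnSr exprM [X in X ^+ _]IHi -in_algE -rmorphXn expf_card.
Qed.

Lemma frob_is_scalable i : scalable (frob i).
Proof.
move=> x a; rewrite -mulr_algl.
by rewrite (frob_is_monoid_morphism i).2 frob_alg mulr_algl.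
Qed.

HB.instance Definition _ i :=
  GRing.isZmodMorphism.Build L L (frob i) (frob_is_zmod_morphism i).
HB.instance Definition _ i :=
  GRing.isMonoidMorphism.Build L L (frob i) (frob_is_monoid_morphism i).
HB.instance Definition _ i :=
  GRing.isScalable.Build F L L *:%R (frob i) (frob_is_scalable i).

Lemma frobD i j a : frob (i + j) a = frob i (frob j a).
Proof. by rewrite /frob -exprM -expnD addnC. Qed.

Lemma frob_dim a : frob n a = a.
Proof. by apply/eqP; rewrite -[_ == _](Fermat's_little_theorem {:L}) memvf. Qed.

Lemma frob1_fixed a : frob 1 a = a -> a \in 1%VS.
Proof.
move=> fix_a; have := Fermat's_little_theorem 1 a; rewrite dimv1 => ->.
exact/eqP.
Qed.

Lemma conj_polyE a : conj_poly a = \sum_(i < n) frob i a *: 'X^(n.-1 - i).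
Proof. by []. Qed.

Lemma size_conj_poly a : (size (conj_poly a) <= n)%N.
Proof.
apply: leq_trans (size_sum _ _ _) _; apply/bigmax_leqP => i _.
apply: leq_trans (size_scale_leq _ _) _; rewrite size_polyXn.
by rewrite (leq_ltn_trans (leq_subr _ _)) // prednK // adim_gt0.
Qed.

(** Only the term [i = 0] reaches degree [n.-1]; hence the conjugate polynomial determines [a]. *)
Lemma coef_conj_poly0 a : (conj_poly a)`_n.-1 = a.
Proof.
rewrite conj_polyE coef_sum; have n_gt0 := adim_gt0 {:L}%AS.
rewrite (bigD1 (Ordinal n_gt0)) //= big1 => [|i i0].
  by rewrite subn0 coefZ coefXn eqxx mulr1 addr0 /frob expr1.
rewrite coefZ coefXn eqn_leq leq_subr andbT leqNgt ltn_subrL.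
have i_gt0 : (0 < i)%N by rewrite lt0n; apply: contra i0.
by rewrite i_gt0 -ltnS prednK // (leq_ltn_trans i_gt0) ?mulr0.
Qed.

Lemma conj_poly_eq0 a : (conj_poly a == 0) = (a == 0).
Proof.
apply/eqP/eqP => [ga0 | ->]; first by rewrite -(coef_conj_poly0 a) ga0 coef0.
by rewrite conj_polyE big1 // => i _; rewrite raddf0 scale0r.
Qed.

Lemma conj_polyD : {morph @conj_poly F L : a b / a + b}.
Proof.
move=> a b; rewrite !conj_polyE -big_split; apply: eq_bigr => i _ /=.
by rewrite raddfD scalerDl.
Qed.

Lemma conj_polyZ x a : conj_poly (x *: a) = x%:A *: conj_poly a.
Proof.
rewrite !conj_polyE scaler_sumr; apply: eq_bigr => i _.
by rewrite linearZ /= scalerA mulr_algl.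
Qed.

Lemma conj_poly_sum (I : Type) (r : seq I) (A : I -> L) :
  conj_poly (\sum_(i <- r) A i) = \sum_(i <- r) conj_poly (A i).
Proof.
apply: (big_morph _ conj_polyD).
by apply/eqP; rewrite conj_poly_eq0.
Qed.

(* Shifting the coefficients of the conjugate polynomial cyclically amounts to
   applying Frobenius. *)
Lemma mulX_conj_poly a :
  'X * conj_poly a = conj_poly (frob 1 a) + a *: ('X^n - 1).
Proof.
rewrite !conj_polyE mulr_sumr; have n_gt0 := adim_gt0 {:L}%AS.
have frobn : frob n a = a := frob_dim a.
case: (\dim _) n_gt0 frobn => // m _ frobm.
(* Isolate the wrap-around: the first summand on the left is [a *: 'X^n], the last one on the right
   is the constant $a^{q^n} = a$. *)
rewrite big_ord_recl big_ord_recr /=.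
rewrite subn0 subnn -frobD addn1 frobm expr0.
rewrite [X in _ = X + _ + _](_ : _ = \sum_(i < m) 'X *
   (frob (bump 0 i) a *: 'X^(m - bump 0 i))); last first.
  apply: eq_bigr => i _; rewrite -frobD addn1 -scalerAr -exprS.
  by rewrite subnSK.
rewrite -scalerAr -exprS /frob expn0 expr1 scalerBr.
by rewrite -addrA [X in _ = _ + X]addrC subrK addrC.
Qed.

Lemma mulXn_conj_poly i a :
  'X^n - 1 %| 'X^i * conj_poly a - conj_poly (frob i a).
Proof.
elim: i a => [|i IHi] a; first by rewrite mul1r /frob expr1 subrr dvdp0.
rewrite exprSr -mulrA mulX_conj_poly mulrDr -addrA [_ * (_ *: _) + _]addrC.
rewrite addrA dvdp_addl; first by rewrite -(addn1 i) frobD IHi.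
by rewrite -mul_polyC mulrA dvdp_mull.
Qed.

(** The operator C(Frobenius), that is, evaluation of the q-polynomial $\sum_i c_i x^{q^i}$
    associated with [C]. *)
Definition frob_poly C a := \sum_(i < size C) C`_i *: frob i a.

Lemma mul_conj_poly C a :
  'X^n - 1 %| C^%:A * conj_poly a - conj_poly (frob_poly C a).
Proof.
have -> : C^%:A = \sum_(i < size C) (C`_i)%:A *: 'X^i.
  exact: poly_def.
rewrite conj_poly_sum mulr_suml -sumrB; elim/big_rec: _ => [|i f _ dvdf].
  exact: dvdp0.
rewrite dvdp_add // conj_polyZ -scalerAl -scalerBr -mul_polyC dvdp_mull //.
exact: mulXn_conj_poly.
Qed.

Lemma frob_poly_linear C : linear (frob_poly C).
Proof.
move=> x a b; rewrite /frob_poly scaler_sumr -big_split.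
apply: eq_bigr => i _; rewrite /= linearP scalerDr !scalerA mulrC //.
Qed.

HB.instance Definition _ C :=
  GRing.isLinear.Build F L L *:%R (frob_poly C) (frob_poly_linear C).

(** A conjugate polynomial has degree below [n], so only zero can be a multiple. *)
Lemma dvdp_Xn_sub_1_conj_poly a : ('X^n - 1 %| conj_poly a) = (a == 0).
Proof.
rewrite -conj_poly_eq0; apply/idP/eqP => [|->]; last exact: dvdp0.
apply: contraTeq => nz_g; apply/negP => /(dvdp_leq nz_g).
by rewrite size_Xn_sub_1 ?adim_gt0 // ltnNge size_conj_poly.
Qed.

(** Multiply by the cofactor [C]: modulo ['X^n - 1], the product [C * conj_poly a] is the conjugate
    polynomial of [frob_poly C a]. *)
Lemma dvdp_conj_poly C D a :
  D * C = 'X^n - 1 -> (D^%:A %| conj_poly a) = (frob_poly C a == 0).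
Proof.
move=> DC; have nzf : 'X^n - 1 != 0 :> {poly F}.
  by rewrite Xn_sub_1_neq0 ?adim_gt0.
have nzC : C^%:A != 0.
  by rewrite map_poly_eq0; apply: contraNneq nzf => C0; rewrite -DC C0 mulr0.
have DCL : D^%:A * C^%:A = 'X^n - 1.
  by rewrite -rmorphM DC rmorphB rmorph1 /= map_polyXn.
rewrite -(dvdp_mul2r _ _ nzC) DCL mulrC -dvdp_Xn_sub_1_conj_poly.
rewrite -[X in _ %| X](subrK (conj_poly (frob_poly C a))).
by rewrite dvdp_addr // mul_conj_poly.
Qed.

Lemma dim_kernel_le C :
  C != 0 -> (\dim (lker (linfun (frob_poly C))) <= (size C).-1)%N.
Proof.
move=> nzC; have q_gt1 := finNzRing_gt1 F.
pose K := lker (linfun (frob_poly C)).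
(* The q-polynomial of [C], of degree $q^{\deg C}$; it vanishes on the kernel, whose $q^{\dim}$
   elements are then bounded by that degree. *)
pose Cq : {poly L} := \sum_(i < size C) (C`_i)%:A *: 'X^(#|F| ^ i).
have sizeC : size C = (size C).-1.+1 by rewrite prednK // size_poly_gt0.
have sizeCq : size Cq = (#|F| ^ (size C).-1).+1.
  have nzlC : (C`_(size C).-1)%:A != 0 :> L.
    by rewrite scaler_eq0 oner_eq0 orbF -lead_coefE lead_coef_eq0.
  rewrite /Cq sizeC big_ord_recr /= addrC size_polyDl.
    by rewrite size_scale ?size_polyXn.
  rewrite size_scale ?size_polyXn //.
  rewrite ltnS; apply: leq_trans (size_sum _ _ _) _.
  apply/bigmax_leqP => i _; apply: leq_trans (size_scale_leq _ _) _.
  by rewrite size_polyXn ltn_exp2l.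
pose KS : {vspace finvect_type L} := K.
have roots : all (root Cq) (enum KS).
  apply/(@allP (finvect_type L)) => a.
  rewrite mem_enum memv_ker lfunE /= => /eqP Ca0.
  rewrite /root /Cq horner_sum -[X in _ == X]Ca0; apply/eqP.
  by apply: eq_bigr => i _; rewrite hornerZ hornerXn mulr_algl.
have nzCq : Cq != 0 by rewrite -size_poly_gt0 sizeCq.
have := max_poly_roots nzCq roots (enum_uniq _); rewrite sizeCq ltnS => leK.
rewrite -(leq_exp2l _ _ q_gt1); apply: leq_trans leK.
by rewrite -(card_vspace KS) cardE.
Qed.

(** By rank-nullity and $\deg C + \deg D = n$, the upper bounds on kernel and image leave no
    slack. *)
Lemma dim_kernel C D :
  D * C = 'X^n - 1 -> \dim (lker (linfun (frob_poly C))) = (size C).-1.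
Proof.
move=> DC; have nzf : D * C != 0 by rewrite DC Xn_sub_1_neq0 ?adim_gt0.
have [nzD nzC] : D != 0 /\ C != 0 by apply/norP; rewrite -mulf_eq0.
apply/eqP; rewrite eqn_leq dim_kernel_le //=.
have leD : (\dim (limg (linfun (frob_poly C))) <= (size D).-1)%N.
  apply: leq_trans (dim_kernel_le nzD).
  apply/dimvS/subvP => _ /memv_imgP[a _ ->].
  (* With the roles of [C] and [D] exchanged, an element is killed by D(Frobenius) when [C] divides
     its conjugate polynomial; here that polynomial is [C * conj_poly a] modulo ['X^n - 1], a
     multiple of [C]. *)
  rewrite memv_ker !lfunE /= -(dvdp_conj_poly (D := C)) 1?mulrC //.
  have CL : C^%:A %| 'X^n - 1.
    apply/dvdpP; exists D^%:A.
    by rewrite -rmorphM DC rmorphB rmorph1 /= map_polyXn.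
  have := dvdp_trans CL (mul_conj_poly C a).
  by rewrite dvdp_subr // dvdp_mulr.
have := limg_ker_dim (linfun (frob_poly C)) {:L}; rewrite capfv => dimL.
have : ((size D).-1 + (size C).-1 = n)%N.
  have := congr1 (fun p : {poly F} => (size p).-1) DC.
  by rewrite size_Xn_sub_1 ?adim_gt0 //= size_mul_pred.
rewrite -[in RHS]dimL addnC => eq_dim.
by rewrite -(leq_add2r (size D).-1) eq_dim leq_add2l.
Qed.

Lemma card_dvdp_conj_poly D :
  D %| 'X^n - 1 ->
  #|[set a : finvect_type L | D^%:A %| conj_poly (a : L)]| =
    (#|F| ^ (n - (size D).-1))%N.
Proof.
case/dvdpP=> C DC; have {}DC : D * C = 'X^n - 1 by rewrite DC mulrC.
have nzf : D * C != 0.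
  by rewrite DC -size_poly_gt0 size_Xn_sub_1 // adim_gt0.
have <- : (size C).-1 = (n - (size D).-1)%N.
  have := congr1 (fun p : {poly F} => (size p).-1) DC.
  by rewrite size_Xn_sub_1 ?adim_gt0 //= size_mul_pred // => <-; rewrite addKn.
rewrite -(dim_kernel DC).
pose K : {vspace finvect_type L} := lker (linfun (frob_poly C)).
rewrite -[RHS](card_vspace K); apply: eq_card => a.
by rewrite inE memv_ker lfunE /= -(dvdp_conj_poly a DC).
Qed.

Lemma map_frob_conj_poly i a :
  map_poly (frob i) (conj_poly a) = conj_poly (frob i a).
Proof.
rewrite !conj_polyE rmorph_sum; apply: eq_bigr => j _ /=.
rewrite map_polyZ map_polyXn; congr (_ *: _).
by rewrite /= /frob -!exprM mulnC.
Qed.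

(** Frobenius sends the monic gcd [h] to a monic common divisor of the same degree, hence to itself,
    so its coefficients lie in [F]. *)
Lemma gcd_conj_poly_descent a :
  exists2 G, G \is monic & G^%:A %= gcdp ('X^n - 1) (conj_poly a).
Proof.
set g := gcdp _ _; have n_gt0 : (0 < n)%N := adim_gt0 {:L}%AS.
have nzf : 'X^n - 1 != 0 :> {poly L} by rewrite Xn_sub_1_neq0.
have nzg : g != 0 by rewrite gcdp_eq0 negb_and nzf.
have nzlg : (lead_coef g)^-1 != 0 by rewrite invr_eq0 lead_coef_eq0.
pose h := (lead_coef g)^-1 *: g.
have hg : h %= g by apply: eqp_scale.
have mh : h \is monic.
  by apply/monicP; rewrite lead_coefZ mulVf // lead_coef_eq0.
have dvdhf : map_poly (frob 1) h %| 'X^n - 1.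
  have -> : 'X^n - 1 = map_poly (frob 1) ('X^n - 1).
    by rewrite rmorphB rmorph1 /= map_polyXn.
  by rewrite dvdp_map (eqp_dvdl _ hg) dvdp_gcdl.
have dvdhg : map_poly (frob 1) h %| conj_poly a.
  have : map_poly (frob 1) h %| 'X * conj_poly a.
    rewrite mulX_conj_poly -map_frob_conj_poly dvdp_add //.
      by rewrite dvdp_map (eqp_dvdl _ hg) dvdp_gcdr.
    by rewrite -mul_polyC dvdp_mull.
  (* The factor ['X] cancels, since a divisor of ['X^n - 1] does not vanish at 0. *)
  rewrite Gauss_dvdpr // coprimepX; apply/negP => /(root_dvdp dvdhf).
  by rewrite /root !hornerE expr0n gtn_eqF // sub0r oppr_eq0 oner_eq0.
have fixh : map_poly (frob 1) h = h.
  apply/eqP; rewrite -eqp_monic ?monic_map // -dvdp_size_eqp.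
    by rewrite size_map_poly.
  by rewrite (eqp_dvdr _ hg) dvdp_gcd dvdhf.
have /polyOver1P[G DG] : h \is a polyOver 1%VS.
  apply/polyOverP => i; apply: frob1_fixed.
  by rewrite -[in RHS]fixh coef_map.
exists G; last by rewrite -DG.
by rewrite -(map_monic (in_alg L)) -DG.
Qed.

End Frobenius.

(** * Inclusion-exclusion over irreducible factors *)

Section ExactOrder.

Variables (F : finFieldType) (L : fieldExtType F).
Local Notation n := (\dim {:L}).
Local Notation "p ^%:A" := (map_poly (in_alg L) p)
  (format "p ^%:A") : ring_scope.
Implicit Types (D P : {poly F}) (s : seq {poly F}).

(** For a monic divisor [D] of ['X^n - 1], if [s] lists all monic irreducible [P] with [P * D]
    dividing ['X^n - 1], this says that the monic gcd is [D]. *)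
Definition exact_dvd D s (a : L) :=
  (D^%:A %| conj_poly a) && all (fun P => ~~ ((P * D)^%:A %| conj_poly a)) s.

(** Sieve by one factor at a time: the elements that [P] excludes are those counted for [P * D] with
    the rest of the list, so the induction on [s] keeps [D] arbitrary. *)
Lemma card_exact_dvd D s :
  uniq s -> all (@monic_irr F) s ->
  (\prod_(P <- s) P) * D %| 'X^n - 1 ->
  #|[set a : finvect_type L | exact_dvd D s (a : L)]| =
    (#|F| ^ (n - (size D).-1 - \sum_(P <- s) (size P).-1)
      * \prod_(P <- s) (#|F| ^ (size P).-1 - 1))%N.
Proof.
have nzf : 'X^n - 1 != 0 :> {poly F} by rewrite Xn_sub_1_neq0 ?adim_gt0.
elim: s D => [|P s IHs] D /=.
  rewrite !big_nil mul1r subn0 muln1 => _ _ dvdD.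
  rewrite -card_dvdp_conj_poly //; apply: eq_card => a.
  by rewrite !inE /exact_dvd andbT.
case/andP=> s'P uniq_s /andP[irrP irrs]; rewrite !big_cons => dvdPsD.
have nzPsD := dvdpN0 dvdPsD nzf.
have [nzP nzD] : P != 0 /\ D != 0.
  by move: nzPsD; rewrite !mulf_eq0 !negb_or => /andP[/andP[-> _] ->].
have dvdsD : \prod_(Q <- s) Q * D %| 'X^n - 1.
  by apply: dvdp_trans dvdPsD; rewrite -mulrA dvdp_mull.
have dvdsPD : \prod_(Q <- s) Q * (P * D) %| 'X^n - 1.
  by rewrite mulrCA mulrA.
have sizePD : (size (P * D)).-1 = ((size P).-1 + (size D).-1)%N.
  by rewrite size_mul_pred // mulf_neq0.
have le_n : ((size P).-1 + \sum_(Q <- s) (size Q).-1 + (size D).-1 <= n)%N.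
  have := dvdp_leq nzf dvdPsD; rewrite size_Xn_sub_1 ?adim_gt0 //.
  have irrPs : all (@monic_irr F) (P :: s) by rewrite /= irrP.
  have := size_prod_monic_irr irrPs; rewrite !big_cons => <-.
  rewrite -size_mul_pred //; move: nzPsD; rewrite -size_poly_gt0.
  by case: (size _).
(* [D] may share factors with [P] or [Q], so it is cancelled first; then the coprime [P] and [Q]
   both divide the quotient. *)
have dvd_mulPD a : (P * D)^%:A %| conj_poly a -> {in s, forall Q,
    ((Q * (P * D))^%:A %| conj_poly a) = ((Q * D)^%:A %| conj_poly a)}.
  move=> dvdPD Q sQ; apply/idP/idP => [|dvdQD].
    by apply: dvdp_trans; rewrite dvdp_map mulrCA dvdp_mull.
  have coQP : coprimep Q P.
    rewrite (monic_irr_coprime _ irrP) ?(allP irrs) //.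
    by apply: contraNneq s'P => <-.
  have nzDL : D^%:A != 0 by rewrite map_poly_eq0.
  have /dvdpP[h Dg] : D^%:A %| conj_poly a.
    by apply: dvdp_trans dvdPD; rewrite dvdp_map dvdp_mull.
  move: dvdPD dvdQD; rewrite Dg !rmorphM /= mulrA !dvdp_mul2r // => dvdPh dvdQh.
  by rewrite Gauss_dvdp ?coprimep_map ?dvdPh ?dvdQh.
have dvdD a : (P * D)^%:A %| conj_poly a -> D^%:A %| conj_poly a.
  by apply: dvdp_trans; rewrite dvdp_map dvdp_mull.
have allPD a : (P * D)^%:A %| conj_poly a ->
    all (fun Q => ~~ ((Q * (P * D))^%:A %| conj_poly a)) s =
    all (fun Q => ~~ ((Q * D)^%:A %| conj_poly a)) s.
  by move=> dvdPD; apply: eq_in_all => Q sQ; rewrite dvd_mulPD.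
have cardB := IHs _ uniq_s irrs dvdsPD; have cardA := IHs _ uniq_s irrs dvdsD.
pose A := [set a : finvect_type L | exact_dvd D s (a : L)].
pose B := [set a : finvect_type L | exact_dvd (P * D) s (a : L)].
have sBA : B \subset A.
  apply/subsetP => a; rewrite !inE /exact_dvd => /andP[dvdPD].
  by rewrite allPD // dvdD.
have -> : [set a : finvect_type L | exact_dvd D (P :: s) (a : L)] = A :\: B.
  apply/setP => a; rewrite !inE /exact_dvd /=.
  have [dvdPD | _] := boolP ((P * D)^%:A %| _); last by [].
  by rewrite allPD // andbF; case: all; rewrite ?andbF.
rewrite cardsD (setIidPr sBA) cardA cardB sizePD.
set dP := (size P).-1 in le_n *; set dD := (size D).-1 in le_n *.
set S := (\sum_(Q <- s) _)%N in le_n *.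
(* Writing [n] as a sum removes the truncated subtractions; what remains is $q^{m+dP} - q^m =
   q^m(q^{dP} - 1)$. *)
have [m ->] : exists m, n = (m + (dP + S) + dD)%N.
  by exists (n - (dP + S + dD))%N; rewrite -addnA subnK.
rewrite (addnC dP dD) subnDA !addnK -[(_ - dP - S)%N]subnDA addnK addnA addnK.
by rewrite expnD mulnA mulnBr muln1 mulnBl.
Qed.

End ExactOrder.

(** * Degrees of the irreducible factors of $x^{q^d} - x$ *)

Section Degrees.

Variable F : finFieldType.

(** In the field [K] generated by a root [z] of [P], the power [frob d] fixes [z] and hence every
    polynomial in [z] over [F], that is, all of [K]; its order as a map being the degree of [K],
    that degree divides [d]. *)
Lemma irreducible_dvd_size (P : {poly F}) d :
  irreducible_poly P -> P %| 'X^(#|F| ^ d) - 'X -> ((size P).-1 %| d)%N.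
Proof.
move=> irrP dvdP; have [K dimK [z rootz genz]] := irredp_FAdjoin irrP.
have fixz : frob d z = z.
  apply/eqP; rewrite -subr_eq0.
  have : root (map_poly (in_alg K) ('X^(#|F| ^ d) - 'X)) z.
    by apply: root_dvdp rootz; rewrite dvdp_map.
  by rewrite rmorphB /= map_polyXn map_polyX /root !hornerE.
have fix_all (y : K) : frob d y = y.
  have /Fadjoin_polyP[p /polyOver1P[g ->] ->] : y \in <<1; z>>%VS.
    by rewrite genz memvf.
  rewrite -horner_map /= fixz; congr _.[z].
  by rewrite -map_poly_comp; apply: eq_map_poly => x /=; rewrite frob_alg.
rewrite -dimK; set r := \dim _.
have r_gt0 : (0 < r)%N := adim_gt0 {:K}.
have fix_mod (y : K) : frob (d %% r) y = y.
  have fixm m : frob (m * r) y = y.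
    by elim: m => [|m IHm]; rewrite ?mulSn ?frobD ?IHm ?frob_dim // /frob expr1.
  have {2}<- := fix_all y; rewrite [in RHS](divn_eq d r) addnC frobD.
  by rewrite fixm.
(* A positive remainder makes $x^{q^{d \bmod r}} - x$ a nonzero polynomial vanishing on all $q^r$
   elements of [K], more than its degree allows. *)
apply: contraT; rewrite /dvdn -lt0n => m_gt0.
have q_gt1 := finNzRing_gt1 F.
pose p : {poly K} := 'X^(#|F| ^ (d %% r)) - 'X.
have q_le : (1 < #|F| ^ (d %% r))%N.
  by apply: (leq_trans q_gt1); rewrite -{1}[#|F|]expn1 leq_exp2l.
have size_p : size p = (#|F| ^ (d %% r)).+1.
  by rewrite size_polyDl size_polyXn // size_polyN size_polyX.
have nzp : p != 0 by rewrite -size_poly_gt0 size_p.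
have roots : all (root p) (enum (finvect_type K)).
  apply/allP => y _; rewrite /root /p !hornerE subr_eq0.
  exact/eqP/fix_mod.
have := max_poly_roots nzp roots (enum_uniq _); rewrite size_p ltnS => leK.
have : (#|F| ^ r <= #|F| ^ (d %% r))%N.
  apply: leq_trans leK.
  by rewrite -(card_vspace {: finvect_type K}) card_vspacef cardE.
by rewrite leq_exp2l // leqNgt ltn_mod r_gt0.
Qed.

End Degrees.

(** * Regrouping factors by degree *)

Lemma prod_count_mem (phi : nat -> nat) (t ds : seq nat) :
  uniq ds -> {subset t <= ds} ->
  (\prod_(k <- t) phi k = \prod_(r <- ds) phi r ^ count_mem r t)%N.
Proof.
move=> uniq_ds; elim: t => [_|k t IHt sub_t].
  by rewrite big_nil big1 // => r _; rewrite expn0.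
rewrite big_cons IHt => [|r tr]; last by apply: sub_t; rewrite inE tr orbT.
have ds_k : k \in ds by apply: sub_t; rewrite inE eqxx.
rewrite !(bigD1_seq k) //= eqxx expnS mulnA; congr (_ * _)%N.
by apply: eq_bigr => r; rewrite eq_sym => /negPf->.
Qed.

Section NumFactors.

Variable F : finFieldType.
Implicit Types (f P : {poly F}) (s : seq {poly F}).

(** Turns $v_r$ into an occurrence count in a list of degrees, the form that [prod_count_mem]
    produces. *)
Lemma num_irr_factorsE f s r :
  (0 < r)%N -> uniq s -> all (@monic_irr F) s ->
  (forall P, monic_irr P -> (P %| f) = (P \in s)) ->
  num_irr_factors f r = count_mem r [seq (size P).-1 | P <- s].
Proof.
move=> r_gt0 uniq_s irrs dvd_s; rewrite count_map -size_filter.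
rewrite /num_irr_factors cardE -(size_map val).
apply/perm_size/uniq_perm; rewrite ?filter_uniq //.
  by rewrite (map_inj_uniq val_inj) enum_uniq.
move=> P; rewrite mem_filter /=; apply/mapP/andP => [[h + ->]|[/eqP szP sP]].
  rewrite mem_enum inE => /and4P[/eqP/= szh mh irrh dvdh].
  by rewrite szh -dvd_s // /monic_irr mh.
have irrP := allP irrs _ sP; have /monic_irrP[mP [P1 _]] := irrP.
have szPr : size P = r.+1 by rewrite -szP prednK // ltnW.
have leP : (size P <= r.+1)%N by rewrite szPr.
exists (NPoly leP) => //; rewrite mem_enum inE /= szPr eqxx /=.
by rewrite dvd_s // sP andbT; case/andP: irrP => -> ->.
Qed.

End NumFactors.

(** * Splitting the 1-normal elements by their linear gcd *)

Section OneNormal.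

Variables (F : finFieldType) (L : fieldExtType F).
Local Notation n := (\dim {:L}).
Local Notation "p ^%:A" := (map_poly (in_alg L) p)
  (format "p ^%:A") : ring_scope.
Implicit Types (D P Q : {poly F}) (s : seq {poly F}).

(** For [P] in [s] the [exact_dvd] condition says that the monic gcd [G] over [F] equals [P], so
    each 1-normal element is counted at exactly one linear [P] and every other element at none. *)
Lemma card_1_normal s :
  uniq s -> all (@monic_irr F) s ->
  (forall P, monic_irr P -> (P %| 'X^n - 1) = (P \in s)) ->
  num_k_normal L 1 =
    (\sum_(P <- s | size P == 2%N)
       #|[set a : finvect_type L |
            exact_dvd P [seq Q <- s | Q * P %| 'X^n - 1]%R (a : L)]|)%N.
Proof.
move=> uniq_s irrs dvd_s; pose f : {poly F} := 'X^n - 1.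
rewrite /num_k_normal -sum1_card big_mkcond /=.
under [RHS]eq_bigr do rewrite -sum1_card big_mkcond /=.
rewrite exchange_big /=; apply: eq_bigr => a _; rewrite inE.
have [G mG eqG] := gcd_conj_poly_descent (a : L).
have dvdfL D : (D^%:A %| 'X^n - 1) = (D %| f).
  by rewrite -(dvdp_map (in_alg L)) rmorphB rmorph1 /= map_polyXn.
have dvdgG D : D %| f -> (D^%:A %| conj_poly (a : L)) = (D %| G).
  move=> dvdDf; rewrite -(dvdp_map (in_alg L)) (eqp_dvdr _ eqG) dvdp_gcd.
  by rewrite dvdfL dvdDf.
have dvdGf : G %| f by rewrite -dvdfL (eqp_dvdl _ eqG) dvdp_gcdl.
rewrite /k_normal -(eqp_size eqG) size_map_poly.
have exactE P : P \in s ->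
    exact_dvd P [seq Q <- s | Q * P %| f] (a : L) = (G == P).
  move=> sP; have irrP := allP irrs _ sP.
  have [mP _] := monic_irrP _ irrP.
  rewrite /exact_dvd dvdgG ?dvd_s //.
  have -> : all (fun Q => ~~ ((Q * P)^%:A %| conj_poly (a : L)))
      [seq Q <- s | Q * P %| f] =
    all (fun Q => ~~ (Q * P %| G)) [seq Q <- s | Q * P %| f].
    by apply: eq_in_all => Q; rewrite mem_filter => /andP[/dvdgG-> _].
  apply/andP/eqP => [[/dvdpP[H DG] nQ] | ->]; last first.
    split=> //; apply/allP => Q; rewrite mem_filter => /andP[_ sQ].
    have /monic_irrP[mQ [Q1 _]] := allP irrs _ sQ.
    apply/negP => /(dvdp_leq (monic_neq0 mP)).
    rewrite size_monicM ?monic_neq0 //.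
    rewrite leqNgt => /negP; apply.
    by case: (size Q) Q1 => [|[|k]] // _; rewrite !addSn /= ltnS leq_addl.
  have mH : H \is monic by rewrite -(monicMr _ mP) -DG.
  (* If the cofactor [H] is not constant, an irreducible factor [Q] of it makes [Q * P] divide [G],
     which [nQ] forbids. *)
  have [H1 | /exists_monic_irr_factor[Q irrQ dvdQ]] := leqP (size H) 1.
    suff /eqP H1' : H == 1 by rewrite DG H1' mul1r.
    rewrite -eqp_monic ?monic1 // -size_poly_eq1 eqn_leq H1.
    by rewrite size_poly_gt0 monic_neq0.
  have dvdQPG : Q * P %| G by rewrite DG dvdp_mul.
  have dvdQPf := dvdp_trans dvdQPG dvdGf.
  have sQ : Q \in s by rewrite -dvd_s // (dvdp_trans _ dvdQPf) ?dvdp_mulIl.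
  by have := allP nQ Q; rewrite mem_filter dvdQPf sQ dvdQPG => /(_ isT).
have -> : (\sum_(P <- s | size P == 2) (if a \in [set b : finvect_type L |
       exact_dvd P [seq Q <- s | Q * P %| f]%R (b : L)] then 1 else 0) =
     \sum_(P <- s | size P == 2) (G == P))%N.
  rewrite !(big_seq_cond (fun P => size P == 2)).
  by apply: eq_bigr => P /andP[sP _]; rewrite inE exactE //; case: (_ == _).
have [szG | szG] := eqVneq (size G) 2; last first.
  rewrite big1 // => P /eqP szP; apply/eqP; rewrite eqb0.
  by apply: contra szG => /eqP->; rewrite szP.
have sG : G \in s by rewrite -dvd_s // monic_linear_irr.
rewrite big_mkcond (bigD1_seq G) //= szG !eqxx big1 // => P.
by rewrite eq_sym => /negPf->; rewrite if_same.
Qed.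

End OneNormal.

(** * Irreducible factors of ['X^n - 1] *)

Lemma Xn_sub_1_pchar (F : fieldType) p s m :
  p \in [pchar F] ->
  'X^(p ^ s * m) - 1 = ('X^m - 1) ^+ (p ^ s) :> {poly F}.
Proof.
move=> pcharF; have natp : [pchar {poly F}].-nat (p ^ s)%N.
  rewrite pnatX (eq_pnat _ (@pchar_poly F)) (eq_pnat _ (pcharf_eq pcharF)).
  by rewrite pnat_id // (pcharf_prime pcharF).
by rewrite exprDn_pchar // exprNn_pchar // expr1n -exprM mulnC.
Qed.

Lemma monic_irr_dvd_exp (F : finFieldType) (P h : {poly F}) k :
  monic_irr P -> (0 < k)%N -> (P %| h ^+ k) = (P %| h).
Proof.
move=> irrP; case: k => // k _; elim: k => // k IHk.
by rewrite exprS monic_irr_dvd_mul // IHk orbb.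
Qed.

Lemma dvdp_Xn_sub_1 (R : idomainType) m k :
  (m %| k)%N -> ('X^m - 1 : {poly R}) %| 'X^k - 1.
Proof.
by case/dvdnP=> j ->; rewrite mulnC exprM [X in _ %| X]subrX1 dvdp_mulIl.
Qed.

(** Since [m] divides $q^d - 1$, the polynomial $x^m - 1$ divides $x^{q^d-1} - 1$ and so $x^{q^d} -
    x$. *)
Lemma irr_size_dvd_order (F : finFieldType) (P : {poly F}) m d :
  #|F| ^ d = 1 %[mod m] -> irreducible_poly P -> P %| 'X^m - 1 ->
  ((size P).-1 %| d)%N.
Proof.
move=> /eqP qd irrP dvdP; apply: (irreducible_dvd_size irrP).
have q_gt0 : (0 < #|F| ^ d)%N by rewrite expn_gt0 ltnW ?finNzRing_gt1.
move: qd; rewrite eqn_mod_dvd // => /dvdp_Xn_sub_1 dvdm.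
rewrite -(subnK q_gt0) addn1 exprSr -[X in _ - X]mul1r -mulrBl.
by rewrite dvdp_mulr // (dvdp_trans dvdP).
Qed.

(* The count of 1-normal elements *)
Local Close Scope ring_scope.

Theorem proposition4p1
    (F : finFieldType) (L : fieldExtType F)
    (q p n s n0 d : nat) (v : nat -> nat)
    (hq : #|F| = q)
    (hp : (p \in [pchar F])%R)
    (hn : \dim {:L} = n)
    (hn0 : n = p ^ s * n0)
    (hcop : coprime n0 p)
    (hd_gt0 : 0 < d)
    (hd : q ^ d = 1 %[mod n0])
    (hd_min : forall e : nat, 0 < e -> q ^ e = 1 %[mod n0] -> d <= e)
    (hv : forall r : nat, 0 < r ->
      v r = num_irr_factors ('X^n - 1 : {poly F})%R r) :
  num_k_normal L 1 =
    if n != n0 then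
      v 1 * q ^ (n - n0 - 1) * \prod_(r <- divisors d) (q ^ r - 1) ^ v r
    else
      v 1 * (q - 1) ^ (v 1 - 1)
        * \prod_(r <- divisors d | r != 1) (q ^ r - 1) ^ v r.
Proof.
have n_gt0 : 0 < n by rewrite -hn adim_gt0.
have [ps_gt0 n0_gt0] : 0 < p ^ s /\ 0 < n0.
  by apply/andP; rewrite -muln_gt0 -hn0.
have p_pr := pcharf_prime hp.
(* ['X^n - 1] is the [p ^ s]-th power of the separable [h], so both have the same irreducible
   factors. *)
pose h : {poly F} := ('X^n0 - 1)%R.
have Df : ('X^n - 1 = h ^+ (p ^ s) :> {poly F})%R by rewrite hn0 Xn_sub_1_pchar.
have sep_h : separable_poly h.
  apply: cyclotomic.separable_Xn_sub_1.
  by rewrite -(dvdn_pcharf hp) -prime_coprime // coprime_sym.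
have [Ps irrPs Dh] := monic_factorization (monic_Xn_sub_1 F n0_gt0).
have uniqPs : uniq Ps by apply: separable_prod_uniq; rewrite -?Dh.
have dvd_h P : monic_irr P -> (P %| h)%R = (P \in Ps).
  by move=> irrP; rewrite [h]Dh monic_irr_dvd_prod.
have dvd_f P : monic_irr P -> (P %| 'X^n - 1)%R = (P \in Ps).
  by move=> irrP; rewrite Df monic_irr_dvd_exp // dvd_h.
pose degs := [seq (size P).-1 | P : {poly F} <- Ps].
have vE r : 0 < r -> v r = count_mem r degs.
  by move=> r_gt0; rewrite hv // (num_irr_factorsE r_gt0 uniqPs irrPs dvd_f).
have degs_gt0 r : r \in degs -> 0 < r.
  case/mapP=> P /(allP irrPs) /monic_irrP[_ [P1 _]] ->.
  by case: (size P) P1 => [|[]].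
have degs_d : {subset degs <= divisors d}.
  move=> _ /mapP[P sP ->]; rewrite -dvdn_divisors //.
  have irrP := allP irrPs _ sP; have /monic_irrP[_ irrP'] := irrP.
  by apply: (@irr_size_dvd_order _ _ n0); rewrite ?hq // dvd_h.
have sum_degs : \sum_(P <- Ps) (size P).-1 = n0.
  by rewrite -size_prod_monic_irr // -Dh size_Xn_sub_1.
have v1E : v 1 = count (fun P : {poly F} => size P == 2) Ps.
  rewrite vE // count_map; apply: eq_in_count => P /(allP irrPs).
  by case/monic_irrP=> _ [P1 _] /=; case: (size P) P1.
have divs_gt0 r : r \in divisors d -> 0 < r.
  by rewrite -dvdn_divisors // => /dvdn_gt0; apply.
rewrite (card_1_normal uniqPs irrPs); last by rewrite hn.
(* All linear factors contribute the same number [c]; this is the source of the factor [v 1]. *)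
have sum_const (c : nat) (E : {poly F} -> nat) :
    (forall P, P \in Ps -> size P = 2 -> E P = c) ->
    \sum_(P <- Ps | size P == 2) E P = v 1 * c.
  move=> EP; rewrite v1E -sum1_count big_distrl /=.
  rewrite big_seq_cond [RHS]big_seq_cond.
  by apply: eq_bigr => P /andP[sP /eqP/(EP _ sP)->]; rewrite mul1n.
have [nn0 | nn0] /= := eqVneq n n0.
  have ps1 : p ^ s = 1.
    by apply/eqP; rewrite -(eqn_pmul2r n0_gt0) mul1n -hn0 nn0.
  have Dfh : ('X^n - 1 = h :> {poly F})%R by rewrite nn0.
  rewrite -mulnA; apply: sum_const => P sP szP.
  have irrP := allP irrPs _ sP.
  have [rem_s irr_rem] : uniq (rem P Ps) /\ all (@monic_irr F) (rem P Ps).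
    by rewrite rem_uniq //; split=> //; apply/allP => Q /mem_rem /(allP irrPs).
  (* As ['X^n - 1] is squarefree here, [Q * P] divides it exactly when [Q] differs from [P]. *)
  have -> : [seq Q <- Ps | Q * P %| 'X^(\dim {:L}) - 1]%R = rem P Ps.
    rewrite hn Dfh rem_filter //; apply: eq_in_filter => Q sQ /=.
    have irrQ := allP irrPs _ sQ; rewrite -monic_irr_coprime //.
    apply/idP/idP => [dvdQP | coQP]; last by rewrite Gauss_dvdp ?dvd_h ?sQ.
    by have [sqf _] := separable_polyP sep_h; apply: sqf.
  have DPs : (\prod_(Q <- rem P Ps) Q * P = h :> {poly F})%R.
    by rewrite [h]Dh (big_rem P sP) /= mulrC.
  have sum_rem : \sum_(Q <- rem P Ps) (size Q).-1 = n - 1.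
    by rewrite nn0 -sum_degs (big_rem P sP) /= szP add1n subn1.
  (* The degrees of [P] and of the other factors add up to [n], so the power of [q] is 1. *)
  rewrite card_exact_dvd ?hn ?Dfh ?DPs // szP sum_rem subnn expn0 mul1n hq.
  (* Removing the linear [P] lowers the multiplicity of degree 1 by one, and no other. *)
  have -> : \prod_(Q <- rem P Ps) (q ^ (size Q).-1 - 1) =
      \prod_(r <- divisors d) (q ^ r - 1) ^ (v r - (r == 1)).
    rewrite -(big_map (fun Q : {poly F} => (size Q).-1) xpredT
  (fun r => q ^ r - 1)).
    rewrite (prod_count_mem _ (divisors_uniq d)); last first.
      by move=> _ /mapP[Q /mem_rem sQ ->]; apply: degs_d; apply: map_f.
    apply: eq_big_seq => r /divs_gt0 r_gt0; congr (_ ^ _).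
    rewrite vE // /degs !count_map; have /permP-> := perm_to_rem sP.
    by rewrite /= szP (eq_sym r) addKn.
  have d1 : 1 \in divisors d by rewrite -dvdn_divisors ?dvd1n.
  rewrite (bigD1_seq 1) ?divisors_uniq //= expn1; congr (_ * _).
  by apply: eq_bigr => r /negPf->; rewrite subn0.
have ps2 : 1 < p ^ s.
  rewrite ltn_neqAle ps_gt0 andbT.
  by apply: contraNneq nn0 => ps1; rewrite hn0 -ps1 mul1n.
(* Every factor is now repeated, so [Q * P] divides ['X^n - 1] even for [Q = P] and the sieve runs
   over all of [Ps], of total degree [n0]. *)
have dvd_hh : (h * h %| 'X^n - 1)%R by rewrite Df -expr2 dvdp_exp2l.
rewrite -mulnA; apply: sum_const => P sP szP.
have dvdP : (P %| h)%R by rewrite dvd_h ?(allP irrPs).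
have -> : [seq Q <- Ps | Q * P %| 'X^(\dim {:L}) - 1]%R = Ps.
  apply/all_filterP/allP => Q sQ; rewrite hn; apply: dvdp_trans dvd_hh.
  by rewrite dvdp_mul // dvd_h ?(allP irrPs).
rewrite card_exact_dvd // hn; last first.
  by apply: dvdp_trans dvd_hh; rewrite -Dh dvdp_mul.
rewrite szP sum_degs hq subnAC; congr (_ * _).
rewrite -(big_map (fun Q : {poly F} => (size Q).-1) xpredT
  (fun r => q ^ r - 1)).
rewrite (prod_count_mem _ (divisors_uniq d) degs_d).
by apply: eq_big_seq => r /divs_gt0 /vE->.
Qed.
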